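(* Let $P(x)=x^{2}+p_{1}x+p_{0}\in\mathbb{Z}[x]$ with $|p_{0}|\geq 2$, let $\varepsilon\in[0,1)$, and let $k=\lfloor \varepsilon|p_{0}|\rfloor$ (so that $\mathcal{N}_{\varepsilon}=\{-k,\dots,|p_{0}|-1-k\}$). (i) Suppose $\varepsilon\in[0,\tfrac12)$, or $\varepsilon=\tfrac12$ and $|p_0|$ is odd. Then $P$ is an $\varepsilon$-CNS polynomial if and only if either $-k-1\leq p_{1}\leq |p_{0}|-k$ and $p_{0}\geq 2$, or $k+2-|p_{0}|\leq p_{1}\leq k-1$, $p_{0}\leq -3$, and $\varepsilon\in[\tfrac{1}{|p_{0}|},\tfrac12]$. (ii) Suppose $\varepsilon\in(\tfrac12,1)$, or $\varepsilon=\tfrac12$ and $|p_0|$ is even. Then $P$ is an $\varepsilon$-CNS polynomial if and only if either $-|p_{0}|+k\leq p_{1}\leq k+1$ and $p_{0}\geq 2$, or $-k+1\leq p_{1}\leq -k-2+|p_{0}|$, $p_{0}\leq -3$, and $\varepsilon\in[\tfrac12,\tfrac{|p_{0}|-1}{|p_{0}|})$.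
   Context: Let $P(x)=x^{d}+p_{d-1}x^{d-1}+\dots+p_1x+p_0\in\mathbb{Z}[x]$ be monic with $|p_0|\ge 2$, and $\varepsilon\in[0,1)$. Put $\mathcal{N}_{\varepsilon}=[-\varepsilon|p_0|,(1-\varepsilon)|p_0|)\cap\mathbb{Z}$. The pair $(P,\mathcal{N}_\varepsilon)$ is an $\varepsilon$-canonical number system, and $P$ is called an $\varepsilon$-CNS polynomial, if for every $a\in\mathbb{Z}[x]$ there exist an integer $l>0$ and digits $d_0,\dots,d_{l-1}\in\mathcal{N}_\varepsilon$ with $a\equiv\sum_{j=0}^{l-1}d_jx^j \pmod{P}$. *)

(* Defs.v *)
From HB Require Import structures.
From mathcomp Require Import all_boot all_order all_algebra.
From mathcomp Require Import archimedean reals zify.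

Set Implicit Arguments.
Unset Strict Implicit.
Unset Printing Implicit Defensive.

Import Order.TTheory GRing.Theory Num.Theory.
Local Open Scope ring_scope.

Definition digit (R : realType) (eps : R) (p0 : int) : pred int :=
  fun n => - (eps * `|p0|%:~R) <= n%:~R < (1 - eps) * `|p0|%:~R.

(* Congruence modulo the ideal generated by P in Z[x]. *)
Definition poly_eqmod (P a b : {poly int}) : Prop :=
  exists q : {poly int}, a - b = q * P.

(* Meant for P monic with `|P`_0| >= 2 and 0 <= eps < 1. *)
Definition eps_CNS (R : realType) (eps : R) (P : {poly int}) : Prop :=
  forall a : {poly int},
  exists (l : nat) (d : 'I_l -> int),
    [/\ (0 < l)%N,
        forall j, digit eps P`_0 (d j)
      & poly_eqmod P a (\sum_(j < l) (d j)%:P * 'X^j)].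

Lemma digitE (R : realType) (eps : R) (p0 n : int) :
  let k := Num.floor (eps * `|p0|%:~R) in
  digit eps p0 n = (- k <= n <= `|p0| - 1 - k).
Proof.
rewrite /digit mulrBl mul1r; set x := eps * _ => /=.
rewrite lerNl -rmorphN /= -floor_ge_int lerNl; congr (_ && _).
rewrite ltrBrDr addrC -ltrBrDr -rmorphB /= -floor_lt_int.
by move: (Num.floor x) `|p0| => k m; lia.
Qed.

(* Main.v *)
(** Dividing the class of [a] by [x] modulo [P] again and again produces digits
and integer carries; two consecutive carries determine the class, and the step
sends [(x, y)] to [(y, z)] for the unique [z] with
[k - |p0| < p0 z + p1 y + x <= k]. Hence [P] is a CNS polynomial iff every orbit
of this map on Z^2 reaches the origin. When the inequalities hold, this is
checked on a small witness set inside [{-1, 0, 1}^2] and propagates to Z^2 by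
additivity up to errors in that set. When they fail, either [(1, 1)],
[(-1, -1)], [(1, -1)] or [(1, 0)] is periodic of period at most 2, or the carries
never decrease in absolute value. Negating the digits replaces [k] by
[|p0| - 1 - k], which exchanges the two parts of the theorem. *)

Require Import Defs.
From HB Require Import structures.
From mathcomp Require Import all_boot all_order all_algebra.
From mathcomp Require Import archimedean reals.
From mathcomp Require Import zify ring lra.

Set Implicit Arguments.
Unset Strict Implicit.
Unset Printing Implicit Defensive.

Import Order.TTheory GRing.Theory Num.Theory.
Local Open Scope ring_scope.

(** * The carry map on pairs of integers *)

Definition carry (p0 p1 k x y z : int) : bool :=
  k - `|p0| < p0 * z + p1 * y + x <= k.

Inductive reach (p0 p1 k : int) : int -> int -> Prop :=
| reach_zero : reach p0 p1 k 0 0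
| reach_carry x y z :
    carry p0 p1 k x y z -> reach p0 p1 k y z -> reach p0 p1 k x y.

Lemma carry_uniq p0 p1 k x y z z' :
  carry p0 p1 k x y z -> carry p0 p1 k x y z' -> z = z'.
Proof. rewrite /carry; nia. Qed.

Lemma carry_exists p0 p1 k x y : p0 != 0 -> exists z, carry p0 p1 k x y z.
Proof.
move=> p0N0; pose u := k - (p1 * y + x).
(* The remainder of [u] equals [k] minus the middle term of [carry], so its range from 0 to |p0| - 1
   is exactly the required window. *)
exists (u %/ p0)%Z; rewrite /carry.
have := divz_eq u p0; have := modz_ge0 u p0N0; have := ltz_mod u p0N0.
move: (u %/ p0)%Z (u %% p0)%Z => q r; rewrite /u; lia.
Qed.

Lemma reach_opp p0 p1 k x y :
  reach p0 p1 k x y -> reach p0 p1 (`|p0| - 1 - k) (- x) (- y).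
Proof.
elim=> [|{}x {}y z cz _ IH]; first by rewrite oppr0; exact: reach_zero.
by apply: reach_carry IH; move: cz; rewrite /carry; lia.
Qed.

Lemma reach_invariant p0 p1 k (Q : int -> int -> Prop) x y :
    (forall x y z, Q x y -> carry p0 p1 k x y z -> Q y z) ->
  ~ Q 0 0 -> Q x y -> ~ reach p0 p1 k x y.
Proof.
move=> QS Q0 + r; elim: r => // {}x {}y z cz _ IH Qxy.
exact: IH (QS _ _ _ Qxy cz).
Qed.

Lemma reach_periodic2 p0 p1 k x y :
    carry p0 p1 k x y x -> carry p0 p1 k y x y -> (x != 0) || (y != 0) ->
  ~ reach p0 p1 k x y.
Proof.
move=> cx cy nz.
pose Q u v := (u = x /\ v = y) \/ (u = y /\ v = x).
apply: (@reach_invariant _ _ _ Q); rewrite /Q; [|lia|by left].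
move=> u v z [] [-> ->] cz.
  by right; split=> //; apply: carry_uniq cz cx.
by left; split=> //; apply: carry_uniq cz cy.
Qed.

(* Two carries for inputs differing by [v] differ by some [w] with
   [|p0 w + p1 v2 + v1| < |p0|]; a set closed under all such transitions
   therefore absorbs the error committed by adding one of its elements. *)
Lemma reach_witness p0 p1 k (V : int -> int -> Prop) :
    p0 != 0 ->
    (forall x y w, V x y -> `|p0 * w + p1 * y + x| < `|p0| -> V y w) ->
    (forall x y, V x y -> reach p0 p1 k x y) ->
    V 1 0 -> V (- 1) 0 -> V 0 1 -> V 0 (- 1) ->
  forall x y, reach p0 p1 k x y.
Proof.
move=> p0N0 Vclosed Vreach V10 VN10 V01 V0N1.
have add x y u v : reach p0 p1 k x y -> V u v -> reach p0 p1 k (x + u) (y + v).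
  move=> r; elim: r u v => [|{}x {}y z cz _ IH] u v Vuv.
    by rewrite !add0r; exact: Vreach.
  have [z' cz'] := carry_exists p1 k (x + u) (y + v) p0N0.
  have Vw : V v (z' - z) by apply: Vclosed Vuv _; move: cz cz'; rewrite /carry; lia.
  by apply: reach_carry cz' _; have := IH _ _ Vw; rewrite addrCA subrr addr0.
have row x : reach p0 p1 k x 0.
  elim/int_rect: x => [|n IH|n IH]; first exact: reach_zero.
    by rewrite intS addrC -[0]addr0; exact: add.
  by rewrite intS opprD addrC -[0]addr0; exact: add.
move=> x; elim/int_rect=> [|n IH|n IH]; first exact: row.
  by rewrite intS addrC -[x]addr0; exact: add.
by rewrite intS opprD addrC -[x]addr0; exact: add.
Qed.

(** * Residue classes modulo P and their digit expansions *)

Definition quad (p0 p1 : int) : {poly int} := 'X^2 + p1%:P * 'X + p0%:P.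

(* The residue class determined by the last two carries [x] and [y]. *)
Definition carry_poly (p1 x y : int) : {poly int} :=
  - (x + p1 * y)%:P - y%:P * 'X.

Lemma quad_coef0 p0 p1 : (quad p0 p1)`_0 = p0.
Proof. by rewrite /quad !coefE /= mulr0 add0r. Qed.

Lemma size_quad p0 p1 : size (quad p0 p1) = 3%N.
Proof.
rewrite /quad -addrA size_polyDl size_polyXn //.
by rewrite (leq_ltn_trans (size_polyD _ _)) // gtn_max mul_polyC
  (leq_ltn_trans (size_scale_leq _ _)) ?size_polyX // ltnS
  (leq_trans (size_polyC_leq1 _)).
Qed.

(** Division by x: the class of [(x, y)] is a constant plus x times the class of [(y, z)], and
    [carry] says precisely that this constant is a digit. *)
Lemma carry_poly_step p0 p1 x y z :
  carry_poly p1 x y - ((- (p0 * z + p1 * y + x))%:P + carry_poly p1 y z * 'X)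
  = z%:P * quad p0 p1.
Proof. by rewrite /carry_poly /quad; ring. Qed.

Lemma carry_poly_surj p0 p1 (a : {poly int}) :
  exists x y, poly_eqmod (quad p0 p1) a (carry_poly p1 x y).
Proof.
elim/poly_ind: a => [|a c [x [y [q aE]]]].
  by exists 0, 0, 0; rewrite /carry_poly; ring.
(* The division step run backwards: the new first carry is chosen so that the step onto [(x, y)]
   emits the constant [c]. *)
exists (- c - p0 * y - p1 * x), x.
exists (q * 'X - y%:P).
have -> : a = q * quad p0 p1 + carry_poly p1 x y by rewrite -aE; ring.
by rewrite /carry_poly /quad; ring.
Qed.

(** A polynomial of degree at most 1 is a multiple of a monic quadratic only if it is zero. This
    settles the empty expansion. *)
Lemma carry_poly_eq0 p0 p1 x y q :
  carry_poly p1 x y = q * quad p0 p1 -> x = 0 /\ y = 0.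
Proof.
move=> E; have q0 : q = 0.
  apply/eqP/negP => /negP qN0.
  have : (size (q * quad p0 p1)%R <= 2)%N.
    rewrite -E /carry_poly (leq_trans (size_polyD _ _)) // geq_max.
    rewrite -!polyCN !size_polyN (leq_trans (size_polyC_leq1 _)) //.
    by rewrite mul_polyC (leq_trans (size_scale_leq _ _)) ?size_polyX.
  have PN0 : quad p0 p1 != 0 by rewrite -size_poly_gt0 size_quad.
  rewrite size_mul // size_quad; move: qN0; rewrite -size_poly_gt0.
  by clear; case: (size q) => [|n]; rewrite ?addnS.
move: E; rewrite q0 mul0r => E.
have := congr1 (coefp 0) E; have := congr1 (coefp 1) E.
rewrite /= /carry_poly !coefE /=; lia.
Qed.

Lemma reach_expansion p0 p1 k x y :
  reach p0 p1 k x y <->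
  exists2 s : seq int, all (fun d => - k <= d <= `|p0| - 1 - k) s
    & poly_eqmod (quad p0 p1) (carry_poly p1 x y) (Poly s).
Proof.
split=> [|[s]].
  elim=> [|{}x {}y z cz _ [s sD [q qE]]].
    by exists [::] => //; exists 0; rewrite /carry_poly /=; ring.
  exists (- (p0 * z + p1 * y + x) :: s).
    by rewrite /= sD andbT; move: cz; rewrite /carry; lia.
  exists (z%:P + q * 'X); rewrite /= cons_poly_def.
  by rewrite mulrDl -(carry_poly_step p0 p1 x y) -mulrA (mulrC 'X) mulrA -qE; ring.
elim: s x y => [|d s IH] x y /= => [_ [q]|/andP[dD sD] [q]].
  by rewrite subr0 => /carry_poly_eq0[-> ->]; exact: reach_zero.
(* Comparing constant terms identifies the constant term of the quotient as the next carry;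
   cancelling ['X] then leaves the tail [s]. *)
rewrite cons_poly_def => E; pose z := q`_0.
have dE : d = - (p0 * z + p1 * y + x).
  have := congr1 (coefp 0) E; rewrite /= coef0M quad_coef0 -/z /carry_poly.
  by rewrite !coefE /=; lia.
apply: (@reach_carry _ _ _ _ _ z); first by move: dD; rewrite /carry dE; lia.
apply: IH => //.
have [r rE] : exists r, q = r * 'X + z%:P.
  exists (drop_poly 1 q); rewrite -{1}[q](poly_take_drop 1) expr1 addrC.
  by congr (_ + _); apply/polyP => -[|i]; rewrite coef_take_poly coefC.
have XN0 : 'X != 0 :> {poly int} by rewrite polyX_eq0.
exists r; apply: (mulIf XN0).
have := carry_poly_step p0 p1 x y z; rewrite -dE => S.
transitivity ((q - z%:P) * quad p0 p1); last by rewrite rE; ring.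
by rewrite [RHS]mulrBl -E -S; ring.
Qed.

Lemma Poly_sum (s : seq int) :
  Poly s = \sum_(j < size s) (s`_j)%:P * 'X^j.
Proof.
elim: s => [|d s IH]; first by rewrite big_ord0.
rewrite /= cons_poly_def IH big_ord_recl expr0 mulr1 addrC mulr_suml.
by congr (_ + _); apply: eq_bigr => j _; rewrite exprSr mulrA.
Qed.

Lemma eps_CNS_reach (R : realType) (eps : R) p0 p1 :
  0 <= eps < 1 -> p0 != 0 ->
  eps_CNS eps (quad p0 p1) <->
  forall x y, reach p0 p1 (Num.floor (eps * `|p0|%:~R)) x y.
Proof.
move=> heps p0N0; set k := Num.floor _.
have [k0 km] : 0 <= k /\ k < `|p0|.
  rewrite floor_ge_int floor_lt_int; case/andP: heps => e0 e1; split.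
    by rewrite mulr_ge0 // ler0z.
  by rewrite -[ltRHS]mul1r ltr_pM2r // ltr0z normr_gt0.
split=> [cns x y|reachall a].
  have [[|l] [d [l0 dD E]]] := cns (carry_poly p1 x y); first by [].
  apply/reach_expansion; exists (mkseq (d \o inord) l.+1).
    apply/allP => _ /mapP[j _ ->].
    by have := dD (inord j); rewrite quad_coef0 digitE.
  rewrite Poly_sum size_mkseq; congr (poly_eqmod _ _ _): E.
  by apply: eq_bigr => j _; rewrite nth_mkseq //= inord_val.
have [x [y [q qE]]] := carry_poly_surj p0 p1 a.
have /reach_expansion[s /allP sD [r rE]] := reachall x y.
(* One extra leading digit, the default 0 of [nth], keeps the length positive when [s] is empty; 0
   is a digit since 0 <= k < |p0|. *)
exists (size s).+1, (fun j => s`_j); split=> // [j|].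
  rewrite quad_coef0 digitE -/k; have [js|sj] := ltnP j (size s).
    exact/sD/mem_nth.
  by rewrite nth_default //; lia.
exists (q + r); rewrite mulrDl -qE -rE Poly_sum.
by rewrite big_ord_recr /= nth_default // polyC0 mul0r addr0; ring.
Qed.

(** * Sufficiency: witness sets in the unit square *)

Lemma carry_shift_small (p0 t w : int) :
  `|t| <= `|p0| -> `|p0 * w + t| < `|p0| -> -1 <= w <= 1.
Proof. nia. Qed.

Lemma int_pm1_cases (x : int) :
  -1 <= x <= 1 -> [\/ x = -1, x = 0 | x = 1].
Proof.
have [->|] := eqVneq x (-1); first by constructor 1.
have [->|] := eqVneq x 0; first by constructor 2.
by move=> *; constructor 3; lia.
Qed.

(** The bound on [p1 * y + x] confines every error [w] to {-1, 0, 1}, so the closure of the set cut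
    out by [C] becomes a finite check. *)
Lemma reach_unit_square p0 p1 k (C : int -> int -> bool) :
    p0 != 0 ->
    (forall x y, -1 <= x <= 1 -> -1 <= y <= 1 -> C x y ->
       `|p1 * y + x| <= `|p0|) ->
    (forall x y w, -1 <= x <= 1 -> -1 <= y <= 1 -> -1 <= w <= 1 -> C x y ->
       `|p0 * w + p1 * y + x| < `|p0| -> C y w) ->
    (forall x y, -1 <= x <= 1 -> -1 <= y <= 1 -> C x y ->
       reach p0 p1 k x y) ->
    C 1 0 -> C (- 1) 0 -> C 0 1 -> C 0 (- 1) ->
  forall x y, reach p0 p1 k x y.
Proof.
move=> p0N0 Cbound Cclosed Creach C10 CN10 C01 C0N1.
pose V x y := [/\ -1 <= x <= 1, -1 <= y <= 1 & C x y].
apply: (@reach_witness _ _ _ V) => //.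
- move=> x y w [x1 y1 Cxy] lt_w.
  have w1 : -1 <= w <= 1.
    by apply: (carry_shift_small (Cbound _ _ x1 y1 Cxy)); rewrite addrA.
  by split=> //; exact: Cclosed lt_w.
- by move=> x y [*]; exact: Creach.
Qed.

(** A nonzero error [w] must counteract [p1 * y], so a nonzero [y * w] has the sign of
    [- (p0 * p1)]. Hence the set xy >= 0 for p1 < 0, xy <= 0 for p1 > 0, and the full square for p1
    = 0. *)
Lemma reach_all_pos p0 p1 k :
    2 <= p0 -> 0 <= k -> 2 * k < p0 -> - k - 1 <= p1 <= p0 - k ->
  forall x y, reach p0 p1 k x y.
Proof.
move=> p02 k0 km p1b; have p0N0 : p0 != 0 by lia.
have N10 : reach p0 p1 k (-1) 0.
  by apply: (@reach_carry _ _ _ _ _ 0); [rewrite /carry; lia | exact: reach_zero].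
have via x y z : carry p0 p1 k x y z -> reach p0 p1 k y z -> reach p0 p1 k x y.
  exact: reach_carry.
have [p1neg|p1pos|p1E] := ltgtP p1 0.
- have NN : reach p0 p1 k (-1) (-1).
    by apply: (via _ _ 0); rewrite // /carry; lia.
  have N01 : reach p0 p1 k 0 (-1).
    have [p1k|p1k] := eqVneq p1 (- k - 1).
      by apply: (via _ _ (-1)); rewrite // /carry; lia.
    by apply: (via _ _ 0); rewrite // /carry; lia.
  have P10 : reach p0 p1 k 1 0.
    have [k0'|k1] := eqVneq k 0.
      by apply: via N01; rewrite /carry; lia.
    by apply: (via _ _ 0); rewrite ?/carry; [lia | exact: reach_zero].
  have P11 : reach p0 p1 k 1 1 by apply: (via _ _ 0); rewrite // /carry; lia.
  have P01 : reach p0 p1 k 0 1.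
    (* The second case is the corner p0 = 2k + 1, p1 = -k - 1. *)
    have [le_p1|lt_p1] := ltP (k - p0) p1.
      by apply: (via _ _ 0); rewrite // /carry; lia.
    by apply: (via _ _ 1); rewrite // /carry; lia.
  apply: (@reach_unit_square _ _ _ (fun x y => 0 <= x * y)) => //.
  + move=> x y /int_pm1_cases[]-> /int_pm1_cases[]->; lia.
  + move=> x y w /int_pm1_cases[]-> /int_pm1_cases[]->
      /int_pm1_cases[]->; lia.
  + move=> x y /int_pm1_cases[]-> /int_pm1_cases[]-> // _.
    exact: reach_zero.
- have PN : reach p0 p1 k 1 (-1) by apply: (via _ _ 0); rewrite // /carry; lia.
  (* The conditional forms break an apparent circle: (0, -1) relies on (-1, 1) only if p1 = p0 - k,
     (-1, 1) on (1, 0) only if p1 - 1 <= k, and (1, 0) on (0, -1) only if k = 0. Together these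
     would force p0 <= 1. *)
  have N01' : p1 != p0 - k -> reach p0 p1 k 0 (-1).
    by move=> ?; apply: (via _ _ 0); rewrite // /carry; lia.
  have P10' : k != 0 \/ p1 != p0 - k -> reach p0 p1 k 1 0.
    have [k0' [//|/N01' r]|k1 _] := eqVneq k 0.
      by apply: via r; rewrite /carry; lia.
    by apply: (via _ _ 0); rewrite ?/carry; [lia | exact: reach_zero].
  have NP : reach p0 p1 k (-1) 1.
    have [le_p1|lt_p1] := leP (p1 - 1) k.
      by apply: (via _ _ 0); rewrite ?/carry; [lia | apply: P10'; lia].
    by apply: (via _ _ (-1)); rewrite // /carry; lia.
  have N01 : reach p0 p1 k 0 (-1).
    have [p1k|/N01'//] := eqVneq p1 (p0 - k).
    by apply: (via _ _ 1); rewrite // /carry; lia.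
  have P10 : reach p0 p1 k 1 0.
    have [k0'|k1] := eqVneq k 0; last by apply: P10'; left.
    by apply: via N01; rewrite /carry; lia.
  have P01 : reach p0 p1 k 0 1.
    have [le_p1|lt_p1] := leP p1 k.
      by apply: (via _ _ 0); rewrite // /carry; lia.
    by apply: (via _ _ (-1)); rewrite // /carry; lia.
  apply: (@reach_unit_square _ _ _ (fun x y => x * y <= 0)) => //.
  + move=> x y /int_pm1_cases[]-> /int_pm1_cases[]->; lia.
  + move=> x y w /int_pm1_cases[]-> /int_pm1_cases[]->
      /int_pm1_cases[]->; lia.
  + move=> x y /int_pm1_cases[]-> /int_pm1_cases[]-> // _.
    exact: reach_zero.
- subst p1.
  have N1 y : reach p0 0 k y 0 -> reach p0 0 k (-1) y.
    by apply: via; rewrite /carry; lia.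
  have Z1 y : reach p0 0 k y 0 -> reach p0 0 k 0 y.
    by apply: via; rewrite /carry; lia.
  have N01 := Z1 _ N10; have NN := N1 _ N10.
  have P1 y : reach p0 0 k y 0 -> reach p0 0 k y (-1) -> reach p0 0 k 1 y.
    move=> r0 rN; have [k0'|k1] := eqVneq k 0.
      by apply: via rN; rewrite /carry; lia.
    by apply: via r0; rewrite /carry; lia.
  have P10 := P1 _ (reach_zero _ _ _) N01.
  apply: (@reach_unit_square _ _ _ (fun _ _ => true)) => //.
  + move=> x y /int_pm1_cases[]-> /int_pm1_cases[]->; lia.
  + move=> x y /int_pm1_cases[]-> /int_pm1_cases[]-> // _; auto.
    exact: reach_zero.
Qed.

(** With p0 < 0 the two sign patterns trade places. Since 1 <= k, both 1 and -1 lie in the window,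
    so (1, 0) and (-1, 0) drop to the origin at once. *)
Lemma reach_all_neg p0 p1 k :
    p0 <= - 3 -> 1 <= k -> 2 * k < - p0 -> k + 2 + p0 <= p1 <= k - 1 ->
  forall x y, reach p0 p1 k x y.
Proof.
move=> p03 k1 km p1b; have p0N0 : p0 != 0 by lia.
have via x y z : carry p0 p1 k x y z -> reach p0 p1 k y z -> reach p0 p1 k x y.
  exact: reach_carry.
have N10 : reach p0 p1 k (-1) 0.
  by apply: (via _ _ 0); [rewrite /carry; lia | exact: reach_zero].
have P10 : reach p0 p1 k 1 0.
  by apply: (via _ _ 0); [rewrite /carry; lia | exact: reach_zero].
have P01 : reach p0 p1 k 0 1 by apply: (via _ _ 0); rewrite // /carry; lia.
have [p1neg|p1pos] := ltP p1 0.
- have NP : reach p0 p1 k (-1) 1 by apply: (via _ _ 0); rewrite // /carry; lia.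
  have N01 : reach p0 p1 k 0 (-1).
    have [le_p1|lt_p1] := leP (- p1) k.
      by apply: (via _ _ 0); rewrite // /carry; lia.
    by apply: (via _ _ 1); rewrite // /carry; lia.
  have PN : reach p0 p1 k 1 (-1).
    have [le_p1|lt_p1] := leP (1 - p1) k.
      by apply: (via _ _ 0); rewrite // /carry; lia.
    by apply: (via _ _ 1); rewrite // /carry; lia.
  apply: (@reach_unit_square _ _ _ (fun x y => x * y <= 0)) => //.
  + move=> x y /int_pm1_cases[]-> /int_pm1_cases[]->; lia.
  + move=> x y w /int_pm1_cases[]-> /int_pm1_cases[]->
      /int_pm1_cases[]->; lia.
  + move=> x y /int_pm1_cases[]-> /int_pm1_cases[]-> // _.
    exact: reach_zero.
- have N01 : reach p0 p1 k 0 (-1) by apply: (via _ _ 0); rewrite // /carry; lia.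
  have P11 : reach p0 p1 k 1 1 by apply: (via _ _ 0); rewrite // /carry; lia.
  have NN : reach p0 p1 k (-1) (-1).
    by apply: (via _ _ 0); rewrite // /carry; lia.
  apply: (@reach_unit_square _ _ _ (fun x y => 0 <= x * y)) => //.
  + move=> x y /int_pm1_cases[]-> /int_pm1_cases[]->; lia.
  + move=> x y w /int_pm1_cases[]-> /int_pm1_cases[]->
      /int_pm1_cases[]->; lia.
  + move=> x y /int_pm1_cases[]-> /int_pm1_cases[]-> // _.
    exact: reach_zero.
Qed.

(** * Necessity: escaping orbits and cycles *)

(** Once |p1 y + x| >= |p0| |y|, the window, of absolute value below |p0|, forces |z| >= |y|. Along
    the orbit [x] reinforces [p1 * y] when p0 < 0 but opposes it when p0 > 0, whence the strict
    bound there. *)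
Lemma reach_escape p0 p1 k :
    p0 != 0 -> 0 <= k < `|p0| -> `|p0| <= `|p1| -> (0 < p0 -> p0 < `|p1|) ->
  ~ reach p0 p1 k 0 1.
Proof.
move=> p0N0 kb p1b p1b'.
(* The alternation forced on successive carries by the sign of [p0 p1]. *)
pose same := p0 * p1 < 0.
pose Q (x y : int) :=
  [/\ y != 0, `|x| <= `|y| & if same then 0 <= x * y else x * y <= 0].
apply: (@reach_invariant _ _ _ Q); rewrite /Q; last 2 first.
- by case.
- by split=> //; case: ifP; lia.
move=> x y z [yN0 xy sxy]; rewrite /carry => cz.
have [p0neg|p0pos] := ltP p0 0; have [p1neg|p1pos] := ltP p1 0.
- have sE : same = false by rewrite /same; nia.
  rewrite sE in sxy *.
  have [y0|y0] := ltP 0 y.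
    have ? : z <= - y by nia.
    by split; nia.
  have ? : - y <= z by nia.
  by split; nia.
- have sE : same = true by rewrite /same; nia.
  rewrite sE in sxy *.
  have [y0|y0] := ltP 0 y.
    have ? : y <= z by nia.
    by split; nia.
  have ? : z <= y by nia.
  by split; nia.
- have sE : same = true by rewrite /same; nia.
  rewrite sE in sxy *.
  have [y0|y0] := ltP 0 y.
    have ? : y <= z by nia.
    by split; nia.
  have ? : z <= y by nia.
  by split; nia.
- have sE : same = false by rewrite /same; nia.
  rewrite sE in sxy *.
  have [y0|y0] := ltP 0 y.
    have ? : z <= - y by nia.
    by split; nia.
  have ? : - y <= z by nia.
  by split; nia.
Qed.

Lemma reach_all_iff p0 p1 k :
    2 <= `|p0| -> 0 <= k -> 2 * k < `|p0| ->
  (forall x y, reach p0 p1 k x y) <->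
  (- k - 1 <= p1 <= `|p0| - k /\ 2 <= p0) \/
  [/\ k + 2 - `|p0| <= p1 <= k - 1, p0 <= - 3 & 1 <= k].
Proof.
move=> p02 k0 km; split=> [r|[[p1b p0pos]|[p1b p0neg k1]]]; first last.
- by apply: reach_all_neg; lia.
- by apply: reach_all_pos; lia.
have escape : `|p0| <= `|p1| -> (0 < p0 -> p0 < `|p1|) -> False.
  by move=> *; apply: (@reach_escape p0 p1 k) (r 0 1); lia.
have cycle x y : carry p0 p1 k x y x -> carry p0 p1 k y x y ->
    (x != 0) || (y != 0) -> False.
  by move=> cx cy nz; exact: reach_periodic2 cx cy nz (r x y).
have := cycle (-1) (-1); have := cycle 1 (-1); have := cycle 1 1.
have := cycle 1 0; rewrite /carry => c10 c11 c1N cNN.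
(* A value of p1 beyond a bound either is large enough against |p0| to escape, or leaves room for a
   cycle; for p0 < 0 and k = 0 the cycle is (1, 0), (0, 1). *)
have [p0neg|p0pos] := ltP p0 0; [right|left].
  have ub : p1 < k.
    have [//|p1k] := ltP p1 k; exfalso.
    by have [?|?] := ltP p1 (- p0); [apply: c11|apply: escape]; lia.
  have lb : k + 1 - `|p0| < p1.
    have [//|p1k] := ltP (k + 1 - `|p0|) p1; exfalso.
    by have [?|?] := ltP p0 p1; [apply: c1N|apply: escape]; lia.
  have k1 : 1 <= k.
    have [?|//] := ltP k 1; exfalso.
    by apply: c10; lia.
  by split; lia.
split; last by lia.
apply/andP; split.
  have [//|p1k] := leP (- k - 1) p1; exfalso.
  by have [?|?] := ltP p1 (- p0); [apply: escape|apply: cNN]; lia.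
have [//|p1k] := leP p1 (`|p0| - k); exfalso.
by have [?|?] := ltP p0 p1; [apply: escape|apply: c1N]; lia.
Qed.

(** * Exchanging k with |p0| - 1 - k, and the theorem *)

Lemma reach_all_opp p0 p1 k :
  (forall x y, reach p0 p1 k x y) <->
  (forall x y, reach p0 p1 (`|p0| - 1 - k) x y).
Proof.
have half k' : (forall x y, reach p0 p1 k' x y) ->
    forall x y, reach p0 p1 (`|p0| - 1 - k') x y.
  by move=> r x y; rewrite -[x]opprK -[y]opprK; exact/reach_opp/r.
split; first exact: half.
by move/half; rewrite opprB addrC addrNK; congr (forall x y, reach _ _ _ x y).
Qed.

Lemma reach_all_iff_opp p0 p1 k :
    2 <= `|p0| -> k < `|p0| -> `|p0| < 2 * k + 2 ->
  (forall x y, reach p0 p1 k x y) <->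
  (- `|p0| + k <= p1 <= k + 1 /\ 2 <= p0) \/
  [/\ - k + 1 <= p1 <= - k - 2 + `|p0|, p0 <= - 3 & k < `|p0| - 1].
Proof.
move=> p02 km k2; rewrite reach_all_opp reach_all_iff; [|lia..].
by split=> -[[*]|[*]]; [left|right|left|right]; split; lia.
Qed.

Theorem theorem2p4 (R : realType) (p0 p1 : int) (eps : R) (k : int)
    (hp0 : 2 <= `|p0|) (heps : 0 <= eps < 1)
    (hk : k = Num.floor (eps * `|p0|%:~R)) :
  let P : {poly int} := 'X^2 + p1%:P * 'X + p0%:P in
  ((0 <= eps < 1 / 2 \/ (eps = 1 / 2 /\ odd `|p0|%N)) ->
    (eps_CNS eps P <->
      ((- k - 1 <= p1 <= `|p0| - k /\ 2 <= p0) \/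
       [/\ k + 2 - `|p0| <= p1 <= k - 1, p0 <= - 3
         & 1 / `|p0|%:~R <= eps <= 1 / 2])))
  /\
  ((1 / 2 < eps < 1 \/ (eps = 1 / 2 /\ ~~ odd `|p0|%N)) ->
    (eps_CNS eps P <->
      ((- `|p0| + k <= p1 <= k + 1 /\ 2 <= p0) \/
       [/\ - k + 1 <= p1 <= - k - 2 + `|p0|, p0 <= - 3
         & 1 / 2 <= eps < (`|p0| - 1)%:~R / `|p0|%:~R]))).
Proof.
move=> P; have p0N0 : p0 != 0 by lia.
have m0 : 0 < `|p0|%:~R :> R by rewrite ltr0z normr_gt0.
have kle : k%:~R <= eps * `|p0|%:~R by rewrite -floor_ge_int hk.
have klt : eps * `|p0|%:~R < (k + 1)%:~R by rewrite -floor_lt_int -hk; lia.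
have k0 : 0 <= k.
  by case/andP: heps => e0 _; rewrite hk floor_ge_int mulr_ge0 // ltW.
have km : k < `|p0|.
  by case/andP: heps => _ e1; rewrite hk floor_lt_int -[ltRHS]mul1r ltr_pM2r.
have k1E : (1 / `|p0|%:~R <= eps) = (1 <= k).
  by rewrite ler_pdivrMr // hk floor_ge_int.
have k2E : (eps < (`|p0| - 1)%:~R / `|p0|%:~R) = (k < `|p0| - 1).
  by rewrite ltr_pdivlMr // hk floor_lt_int.
rewrite -[P]/(quad p0 p1) eps_CNS_reach // -hk k1E k2E; split=> he.
  have e2 : eps <= 1 / 2 by case: he => [/andP[_ /ltW]|[-> _]].
  have k2 : 2 * k < `|p0|.
    case: he => [/andP[_ lt_e]|[eE odd_p0]].
      by rewrite -(ltr_int R) rmorphM /=; nra.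
    (* At eps = 1/2 the estimate is not strict; oddness of |p0| excludes equality. *)
    have : 2 * k <= `|p0| by rewrite -(ler_int R) rmorphM /=; nra.
    by clear -odd_p0; lia.
  by rewrite reach_all_iff // e2 andbT.
have e2 : 1 / 2 <= eps by case: he => [/andP[/ltW]|[-> _]].
have k2 : `|p0| < 2 * k + 2.
  by rewrite -(ltr_int R) rmorphD rmorphM /=; move: klt; rewrite rmorphD /=; nra.
by rewrite reach_all_iff_opp // e2.
Qed.
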